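(* Let $t>0$, $M>0$, $n\geq1$. The Freud-type polynomial $Q_n^t(x)$ satisfies the holonomic equation (second order linear differential equation) $$\mathcal{A}(x,t;n)[Q_n^t(x)]''+\mathcal{B}(x,t;n)[Q_n^t(x)]'+\mathcal{C}(x,t;n)Q_n^t(x)=0,$$ where (suppressing the arguments $(x,t;n)$) $$\mathcal{A}=\Psi_{1,1}\Delta^2,$$ $$\mathcal{B}=\Delta\left(W\{\Psi_{1,1},\Delta\}+\Psi_{1,1}\left[\Psi_{2,1}-\Psi_{1,2}\right]\right),$$ $$\mathcal{C}=\Delta\, W\{\Psi_{1,1},\Psi_{2,1}\}+\Psi_{1,1}\begin{vmatrix}\Psi_{1,1}&\Psi_{1,2}\\ \Psi_{2,1}&\Psi_{2,2}\end{vmatrix},$$ with $$\Psi_{i,j}=\begin{vmatrix}A_i&C_j\\ B_i&D_j\end{vmatrix},\qquad i,j=1,2.$$ Moreover, the polynomials $\mathcal{A}(x,t;n)$ and $\mathcal{C}(x,t;n)$ are even functions of $x$ and the polynomial $\mathcal{B}(x,t;n)$ is an odd function of $x$. The coefficients of $\mathcal{A}$ and $\mathcal{B}$ are the following, where we abbreviate $a=a_n^2(t)$, $p=a_{n-1}^2(t)$, $q=a_{n+1}^2(t)$, $b=b_n^t$, $c=b_{n-1}^t$. Coefficients of $\mathcal{A}(x,t;n)$: $x^8$: $\ 4abc^2$. $x^6$: $\ 4ac\left\{b\left(a[2(1-b)+c(3b-2)]-tc\right)+qc\right\}$. $x^4$: $\ a(b-1)\left\{4ca\left(c[(b-1)p+(1-3b)t]+2(c-1)q+2tb\right)+4a^2\left[(3b^2-1)c^2+2bc(1-2b)+(b-1)b\right]-c^2\right\}$.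 $x^2$: $\ 2a^2(c-1)(b-1)^2\left\{2a\left[b(t-ba)+c\left(2(b-1)p+a[b(b+2)-2]+t(2-3b)\right)+q(c-1)\right]-c\right\}$. $x^0$: $\ -a^3(c-1)^2(b-1)^3\left\{1-4a[b-1][p+a-t]\right\}$. Coefficients of $\mathcal{B}(x,t;n)$: $x^{11}$: $\ -16abc^2$. $x^9$: $\ -16ac\left\{b\left(a[c(3b-2)+2(1-b)]-2tc\right)+cq\right\}$. $x^7$: $\ -4a\left\{c^2[1-4tq+4t^2b+b]+4ca\left(c[(b-1)^2p+t(6(1-b)b-1)]+2(c-1)(b-1)q+4t(b-1)b\right)+4(b-1)a^2\left[(3b^2-1)c^2+2b(1-2b)c+(b-1)b\right]\right\}$. $x^5$: $\ -4(b-1)a\Big\{2ca\left(c\left(-2t(b-1)p+(6t^2+1)b-2t^2+1\right)-4tq(c-1)-(4t^2+1)b-1\right)+4a^2\Big(2c\left(t(1-2b)^2-p(b-1)^2\right)-c^2\left(-2p(b-1)^2+tb(6b-5)+t\right)+q(b-1)(c-1)^2-2t(b-1)b\Big)+4a^3(c-1)(b-1)\left(c(b(b+2)-2)-b^2\right)+tc^2\Big\}$. $x^3$: $\ -2a(b-1)\Big\{2a^2[b-1]\Big(-2c\left(-4tp[b-1]+8t^2b+b-4t^2+1\right)+c^2\left(-8tp[b-1]+12t^2b+b-8t^2-1\right)-4tq[c-1]^2+4t^2b+b+1\Big)-8a^3[c-1][b-1]\left(-[c-1]\left(p[b-1]^2-2tb^2\right)-t[c-2b+1]\right)+4ac[b-1]\left(c[2t-p]-t\right)+8a^4[c-1]^2[b-1]^3+c^2\Big\}$.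 $x^1$: $\ -4a^2(c-1)(b-1)^2\left(1-4a[b-1][p+a-t]\right)\left(ta[c-1][b-1]+c\right)$.
   Context: Primes denote $d/dx$, and $W\{f,g\}=fg'-f'g$ is the Wronskian in $x$. For polynomials with real coefficients put $\langle p,q\rangle_t=\int_{\mathbb{R}}p(x)q(x)e^{-x^4+2tx^2}dx$ and $\|p\|_t^2=\langle p,p\rangle_t$. $\{F_n^t\}_{n\geq0}$ is the sequence of monic polynomials ($\deg F_n^t=n$) orthogonal with respect to $\langle\cdot,\cdot\rangle_t$; it satisfies $xF_n^t(x)=F_{n+1}^t(x)+a_n^2(t)F_{n-1}^t(x)$ with $F_{-1}^t=0$, $F_0^t=1$, $a_0^2(t)=0$, and $a_n^2(t)=\|F_n^t\|_t^2/\|F_{n-1}^t\|_t^2>0$ for $n\ge1$. The kernel is $K_n(x,y;t)=\sum_{k=0}^n F_k^t(x)F_k^t(y)/\|F_k^t\|_t^2$ (with $K_{-1}=0$). The Freud-type polynomials $\{Q_n^t\}_{n\geq0}$ are the monic polynomials ($\deg Q_n^t=n$) orthogonal with respect to $\langle p,q\rangle=\langle p,q\rangle_t+Mp(0)q(0)$. Put $b_n^t=\dfrac{1+MK_n(0,0;t)}{1+MK_{n-1}(0,0;t)}$ for $n\ge 0$; one has $b_n^t=1$ for $n$ odd, so $(b_n^t-1)(b_{n-1}^t-1)=0$ for every $n\ge1$. For $n\geq1$ define $A_1(x,t;n)=x$, $\ B_1(t;n)=a_n^2(t)(b_n^t-1)$, $\ A_2(t;n)=1-b_{n-1}^t$,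 $\ B_2(x,t;n)=x\,b_{n-1}^t$, $C_1(x,t;n)=-4a_n^2(t)\left[b_n^tx^2+(b_n^t-1)\left(a_{n-1}^2(t)+a_n^2(t)-t\right)\right]$, $D_1(x,t;n)=4a_n^2(t)\,x\left(a_{n+1}^2(t)+b_n^t\left[x^2-t+a_n^2(t)\right]\right)-\frac1x a_n^2(t)(b_n^t-1)$, $C_2(x,t;n)=(b_{n-1}^t-1)\left(4xa_n^2(t)+\frac1x\right)-4x\,b_{n-1}^t\left[x^2-t+a_{n-1}^2(t)+a_n^2(t)\right]$, $D_2(x,t;n)=4a_n^2(t)(1-b_{n-1}^t)\left[x^2-t+a_n^2(t)+a_{n+1}^2(t)\right]+4x^2b_{n-1}^t\left[x^2-t+a_n^2(t)\right]$, $\Delta(x,t;n)=x^2b_{n-1}^t+a_n^2(t)(b_n^t-1)(b_{n-1}^t-1)$. *)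

(* Defs.v *)
(* MathComp-Analysis, over an arbitrary [R : realType]. *)
From HB Require Import structures.
From mathcomp Require Import all_boot all_order all_algebra.
From mathcomp Require Import all_classical all_reals all_analysis.
Set Implicit Arguments.
Unset Strict Implicit.
Unset Printing Implicit Defensive.
Import Order.TTheory GRing.Theory Num.Theory.
Import numFieldNormedType.Exports.
Local Open Scope ring_scope.

Section Orthogonality.
Context {R : realType}.
Implicit Types (t M : R) (p q : {poly R}).

Definition freud_ip t p q : R :=
  \int[lebesgue_measure]_(x in [set: R])
    (p.[x] * q.[x] * expR (- x ^+ 4 + 2 * t * x ^+ 2)).

Definition freud_type_ip t M p q : R :=
  freud_ip t p q + M * p.[0] * q.[0].

Definition freud_sqnorm t p : R := freud_ip t p p.

(* [size p = n.+1] encodes [deg p = n]. *)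
Definition monic_orthogonal_sequence (ip : {poly R} -> {poly R} -> R)
    (P : nat -> {poly R}) : Prop :=
  [/\ forall n, P n \is monic,
      forall n, size (P n) = n.+1 &
      forall m n, m != n -> ip (P m) (P n) = 0].

End Orthogonality.

Section Coefficients.
Context {R : realType}.
Implicit Types (t M x y : R) (F : nat -> {poly R}) (n : nat).

(* The squared recurrence coefficient a_n^2(t), with a_0^2(t) = 0. *)
Definition freud_a2 t F n : R :=
  if n is m.+1 then freud_sqnorm t (F n) / freud_sqnorm t (F m) else 0.

(* The index is shifted by one: [kernel_pred t F n x y] is K_{n-1}(x, y; t),
   so that K_{-1} = 0 is the empty sum at [n = 0]. *)
Definition kernel_pred t F n x y : R :=
  \sum_(k < n) (F k).[x] * (F k).[y] / freud_sqnorm t (F k).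

Definition freud_b t M F n : R :=
  (1 + M * kernel_pred t F n.+1 0 0) / (1 + M * kernel_pred t F n 0 0).

End Coefficients.

(* The determinant | u11 u12 ; u21 u22 |. *)
Definition det2 {R : realType} (u11 u12 u21 u22 : R) : R :=
  u11 * u22 - u12 * u21.

Definition wronskian {R : realType} (f g : R -> R) : R -> R :=
  fun x => f x * derive1 g x - derive1 f x * g x.

(* The functions below contain 1/x; they are meaningful for x <> 0 only. *)
Section Holonomic.
Context {R : realType}.
Variables (t M : R) (F : nat -> {poly R}) (n : nat).

Local Notation a := (freud_a2 t F n).
Local Notation p := (freud_a2 t F n.-1).
Local Notation q := (freud_a2 t F n.+1).
Local Notation b := (freud_b t M F n).
Local Notation c := (freud_b t M F n.-1).

Definition funA1 (x : R) : R := x.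
Definition funB1 (x : R) : R := a * (b - 1).
Definition funA2 (x : R) : R := 1 - c.
Definition funB2 (x : R) : R := x * c.

Definition funC1 (x : R) : R :=
  - (4 * a * (b * x ^+ 2 + (b - 1) * (p + a - t))).

Definition funD1 (x : R) : R :=
  4 * a * x * (q + b * (x ^+ 2 - t + a)) - x^-1 * (a * (b - 1)).

Definition funC2 (x : R) : R :=
  (c - 1) * (4 * x * a + x^-1) - 4 * x * c * (x ^+ 2 - t + p + a).

Definition funD2 (x : R) : R :=
  4 * a * (1 - c) * (x ^+ 2 - t + a + q)
  + 4 * x ^+ 2 * c * (x ^+ 2 - t + a).

Definition funDelta (x : R) : R := x ^+ 2 * c + a * (b - 1) * (c - 1).

Definition Psi11 (x : R) : R := det2 (funA1 x) (funC1 x) (funB1 x) (funD1 x).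
Definition Psi12 (x : R) : R := det2 (funA1 x) (funC2 x) (funB1 x) (funD2 x).
Definition Psi21 (x : R) : R := det2 (funA2 x) (funC1 x) (funB2 x) (funD1 x).
Definition Psi22 (x : R) : R := det2 (funA2 x) (funC2 x) (funB2 x) (funD2 x).

Definition calA (x : R) : R := Psi11 x * funDelta x ^+ 2.

Definition calB (x : R) : R :=
  funDelta x *
    (wronskian Psi11 funDelta x + Psi11 x * (Psi21 x - Psi12 x)).

Definition calC (x : R) : R :=
  funDelta x * wronskian Psi11 Psi21 x
  + Psi11 x * det2 (Psi11 x) (Psi12 x) (Psi21 x) (Psi22 x).

Definition coefA8 : R := 4 * a * b * c ^+ 2.

Definition coefA6 : R :=
  4 * a * c * (b * (a * (2 * (1 - b) + c * (3 * b - 2)) - t * c) + q * c).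

Definition coefA4 : R :=
  a * (b - 1) *
  (4 * c * a * (c * ((b - 1) * p + (1 - 3 * b) * t) + 2 * (c - 1) * q
                + 2 * t * b)
   + 4 * a ^+ 2 * ((3 * b ^+ 2 - 1) * c ^+ 2 + 2 * b * c * (1 - 2 * b)
                   + (b - 1) * b)
   - c ^+ 2).

Definition coefA2 : R :=
  2 * a ^+ 2 * (c - 1) * (b - 1) ^+ 2 *
  (2 * a * (b * (t - b * a)
            + c * (2 * (b - 1) * p + a * (b * (b + 2) - 2)
                   + t * (2 - 3 * b))
            + q * (c - 1))
   - c).

Definition coefA0 : R :=
  - (a ^+ 3 * (c - 1) ^+ 2 * (b - 1) ^+ 3
     * (1 - 4 * a * (b - 1) * (p + a - t))).

Definition coefB11 : R := - (16 * a * b * c ^+ 2).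

Definition coefB9 : R :=
  - (16 * a * c * (b * (a * (c * (3 * b - 2) + 2 * (1 - b)) - 2 * t * c)
                   + c * q)).

Definition coefB7 : R :=
  - (4 * a *
     (c ^+ 2 * (1 - 4 * t * q + 4 * t ^+ 2 * b + b)
      + 4 * c * a * (c * ((b - 1) ^+ 2 * p + t * (6 * (1 - b) * b - 1))
                     + 2 * (c - 1) * (b - 1) * q + 4 * t * (b - 1) * b)
      + 4 * (b - 1) * a ^+ 2 * ((3 * b ^+ 2 - 1) * c ^+ 2
                                + 2 * b * (1 - 2 * b) * c + (b - 1) * b))).

Definition coefB5 : R :=
  - (4 * (b - 1) * a *
     (2 * c * a * (c * (- (2 * t * (b - 1) * p) + (6 * t ^+ 2 + 1) * b
                        - 2 * t ^+ 2 + 1)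
                   - 4 * t * q * (c - 1) - (4 * t ^+ 2 + 1) * b - 1)
      + 4 * a ^+ 2 * (2 * c * (t * (1 - 2 * b) ^+ 2 - p * (b - 1) ^+ 2)
                      - c ^+ 2 * (- (2 * p * (b - 1) ^+ 2)
                                  + t * b * (6 * b - 5) + t)
                      + q * (b - 1) * (c - 1) ^+ 2 - 2 * t * (b - 1) * b)
      + 4 * a ^+ 3 * (c - 1) * (b - 1) * (c * (b * (b + 2) - 2) - b ^+ 2)
      + t * c ^+ 2)).

Definition coefB3 : R :=
  - (2 * a * (b - 1) *
     (2 * a ^+ 2 * (b - 1) *
        (- (2 * c * (- (4 * t * p * (b - 1)) + 8 * t ^+ 2 * b + b
                     - 4 * t ^+ 2 + 1))
         + c ^+ 2 * (- (8 * t * p * (b - 1)) + 12 * t ^+ 2 * b + b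
                     - 8 * t ^+ 2 - 1)
         - 4 * t * q * (c - 1) ^+ 2 + 4 * t ^+ 2 * b + b + 1)
      - 8 * a ^+ 3 * (c - 1) * (b - 1) *
          (- ((c - 1) * (p * (b - 1) ^+ 2 - 2 * t * b ^+ 2))
           - t * (c - 2 * b + 1))
      + 4 * a * c * (b - 1) * (c * (2 * t - p) - t)
      + 8 * a ^+ 4 * (c - 1) ^+ 2 * (b - 1) ^+ 3 + c ^+ 2)).

Definition coefB1 : R :=
  - (4 * a ^+ 2 * (c - 1) * (b - 1) ^+ 2
     * (1 - 4 * a * (b - 1) * (p + a - t))
     * (t * a * (c - 1) * (b - 1) + c)).

Definition explicitA : {poly R} :=
  coefA8 *: 'X^8 + coefA6 *: 'X^6 + coefA4 *: 'X^4 + coefA2 *: 'X^2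
  + coefA0%:P.

Definition explicitB : {poly R} :=
  coefB11 *: 'X^11 + coefB9 *: 'X^9 + coefB7 *: 'X^7 + coefB5 *: 'X^5
  + coefB3 *: 'X^3 + coefB1 *: 'X.

End Holonomic.

(* Main.v *)
From HB Require Import structures.
Require Import Defs.
From mathcomp Require Import all_boot all_order all_algebra.
From mathcomp Require Import all_classical all_reals all_analysis.
From mathcomp Require Import measurable_realfun ring.
Import Order.TTheory GRing.Theory Num.Theory.
Import numFieldNormedType.Exports.
Set Implicit Arguments.
Unset Strict Implicit.
Unset Printing Implicit Defensive.
Local Open Scope classical_set_scope.
Local Open Scope ring_scope.

(** Everything follows from a pair of first-order ladder relations. Write a_n
    for the squared recurrence coefficients and b_n for the ratios of
    1 + M K_n(0, 0).

    The weight w = exp(-x^4 + 2 t x^2) makes L(p) = \int p w a positive linear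
    form which is invariant under x -> -x, and since w' = -(4 x^3 - 4 t x) w
    decays at infinity, integration by parts reads
    L(p') = L(p (4 x^3 - 4 t x)) ([freud_moment_gt0], [freud_moment_reflect],
    [freud_moment_deriv]). From here on, no integral is needed.

    Invariance under reflection gives the parity of F_n and the recurrence
    x F_n = F_{n+1} + a_n F_{n-1}. Integration by parts shows that F_n' differs
    from a combination of F_n and F_{n-1} with polynomial coefficients by a
    polynomial of degree less than n which is orthogonal to all such
    polynomials, hence zero ([freud_structure]).

    The point mass at 0 perturbs F_n along the kernel K_{n-1}(x, 0), and x
    times this kernel is a combination of two consecutive F's by
    Christoffel-Darboux. As F_n(0) F_{n+1}(0) = 0 by parity, what is left is
    x Q_n = b_n x F_n - (b_n - 1) F_{n+1} ([freud_type_connection]); the same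
    vanishing gives (b_n - 1)(b_{n-1} - 1) = 0 ([freud_b_consecutive]).

    So x Q_n and x Q_{n-1} are combinations of F_n and F_{n-1}. Differentiating
    and inverting this 2 x 2 system, whose determinant is Delta, yields
    Delta Q_n' = Psi11 Q_{n-1} - Psi21 Q_n and
    Delta Q_{n-1}' = Psi12 Q_{n-1} - Psi22 Q_n ([ladder_u], [ladder_v]), and
    eliminating Q_{n-1} between them gives the second-order equation
    ([ladder_elimination]). The relation (b_n - 1)(b_{n-1} - 1) = 0 cancels
    the 1/x terms, which is why all coefficients are polynomials; it also
    reduces the comparison with the explicit coefficients to the two cases
    b_n = 1 and b_{n-1} = 1, each a polynomial identity. *)

(** * Domination of the weight by a Gaussian *)

Section Weight.
Context {R : realType}.
Implicit Types (t x : R) (p q : {poly R}).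
Local Notation mu := (@lebesgue_measure R).

Definition freud_weight t x : R := expR (- x ^+ 4 + 2 * t * x ^+ 2).

Lemma freud_weight_gt0 t x : 0 < freud_weight t x.
Proof. exact: expR_gt0. Qed.

Lemma freud_weightN t x : freud_weight t (- x) = freud_weight t x.
Proof. by rewrite /freud_weight (exprM (- x) 2 2) sqrrN -exprM. Qed.

(** The exponents differ by half the square of x^2 - (2 t + 1); half of the
    quartic decay is kept to absorb polynomial factors. *)
Lemma freud_weight_le t x :
  freud_weight t x
    <= expR ((2 * t + 1) ^+ 2 / 2) * (gauss_fun x / expR (x ^+ 4 / 2)).
Proof.
rewrite /freud_weight /gauss_fun -expRB -expRD ler_expR -subr_ge0.
rewrite [leRHS](_ : _ = (x ^+ 2 - (2 * t + 1)) ^+ 2 / 2); last by field.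
by rewrite divr_ge0 ?sqr_ge0.
Qed.

(** With u = x^4 / 2, a single term of the exponential series gives
    u^(k+1) <= (k+1)! exp u, and |x|^k <= 1 + (x^4)^(k+1). *)
Lemma pow_le_expR_quartic k :
  exists2 C : R, 0 <= C & forall x, `|x| ^+ k <= C * expR (x ^+ 4 / 2).
Proof.
exists (1 + 2 ^+ k.+1 * k.+1`!%:R); first by rewrite addr_ge0 ?mulr_ge0.
move=> x; set u := x ^+ 4 / 2.
have u0 : 0 <= u by rewrite divr_ge0 // (exprM x 2 2) sqr_ge0.
have e1 : 1 <= expR u.
  by rewrite -[leLHS]addr0 (le_trans _ (expR_ge1Dx u)) // lerD2l.
have uk : (2 * u) ^+ k.+1 <= 2 ^+ k.+1 * k.+1`!%:R * expR u.
  rewrite exprMn -mulrA ler_pM2l ?exprn_gt0 // mulrC.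
  rewrite -ler_pdivrMr ?ltr0n ?fact_gt0 //.
  by apply: le_trans (expR_ge1Dxn k u0); rewrite lerDr.
rewrite mulrDl mul1r.
have [x1|/ltW x1] := leP `|x| 1.
  rewrite (le_trans (exprn_ile1 k (normr_ge0 x) x1)) // (le_trans e1) // lerDl.
  by rewrite !mulr_ge0 ?expR_ge0.
rewrite -[leLHS]add0r lerD ?expR_ge0 //; apply: le_trans uk.
have -> : 2 * u = `|x| ^+ 4.
  by rewrite /u mulrC divfK // -normrX ger0_norm // (exprM x 2 2) sqr_ge0.
rewrite -exprM; apply: ler_weXn2l => //.
by rewrite mulnC (leq_trans (leqnSn k)) // leq_pmulr.
Qed.

Lemma poly_weight_le_gauss t p :
  exists C : R, forall x, `|p.[x] * freud_weight t x| <= C * gauss_fun x.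
Proof.
have /choice [C CP] k : exists C : R,
    0 <= C /\ forall x, `|x| ^+ k <= C * expR (x ^+ 4 / 2).
  by have [C C0 CP] := pow_le_expR_quartic k; exists C.
exists ((\sum_(i < size p) `|p`_i| * C i) * expR ((2 * t + 1) ^+ 2 / 2)) => x.
have px : `|p.[x]| <= (\sum_(i < size p) `|p`_i| * C i) * expR (x ^+ 4 / 2).
  rewrite horner_coef (le_trans (ler_norm_sum _ _ _)) // mulr_suml.
  rewrite ler_sum // => i _.
  by rewrite normrM normrX -mulrA ler_wpM2l // (CP i).2.
rewrite normrM (gtr0_norm (freud_weight_gt0 t x)).
apply: (le_trans (ler_pM _ _ px (freud_weight_le t x))) => //.
  exact/ltW/freud_weight_gt0.
by rewrite mulrACA -!mulrA ler_wpM2l ?sumr_ge0 // => [i _|];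
  rewrite ?mulr_ge0 ?(CP _).1 // ler_wpM2l ?expR_ge0 //
    mulrCA divff ?mulr1 // gt_eqF ?expR_gt0.
Qed.

Lemma continuous_freud_weight t : continuous (freud_weight t).
Proof.
have -> : freud_weight t = expR \o horner (- 'X^4 + (2 * t) *: 'X^2).
  by apply/funext => x /=; rewrite /freud_weight !hornerE.
by move=> x; apply: continuous_comp;
  [exact: continuous_horner|exact: continuous_expR].
Qed.

Lemma continuous_poly_weight t p : continuous (fun x => p.[x] * freud_weight t x).
Proof.
by move=> x; apply: cvgM;
  [exact: continuous_horner|exact: continuous_freud_weight].
Qed.

Lemma integrable_poly_weight t p :
  mu.-integrable setT (EFin \o (fun x => p.[x] * freud_weight t x)).
Proof.
have [C CP] := poly_weight_le_gauss t p.
apply: (@le_integrable _ _ _ mu setT measurableT _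
  (fun x => C%:E * (gauss_fun x)%:E)%E).
- apply/measurable_EFinP; apply: continuous_measurable_fun.
  exact: continuous_poly_weight.
- move=> x _ /=; rewrite lee_fin (le_trans (CP x)) //.
  by rewrite -[leLHS]ger0_norm ?ler_norm // (le_trans _ (CP x)).
- by apply: integrableZl => //; exact: integrableT_gauss.
Qed.

End Weight.

(** * The moment functional of the weight *)

Lemma finite_root (K : fieldType) (p : {poly K}) :
  p != 0 -> finite_set [set x : K | root p x].
Proof.
elim: {p}(size p) {-2}p (leqnn (size p)) => [|n IHn] p.
  by rewrite leqn0 size_poly_eq0 => ->.
move=> sp p0; have [[x px]|nx] := pselect (exists x : K, root p x); last first.
  rewrite (_ : [set x | _] = set0) //.
  by apply/seteqP; split => // x px; apply: nx; exists x.
have [q pE] := factor_theorem _ _ px.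
have q0 : q != 0 by apply: contraNneq p0 => q0; rewrite pE q0 mul0r.
apply: (@sub_finite_set _ _ ([set y | root q y] `|` [set x])).
  by move=> y /=; rewrite pE rootM root_XsubC => /orP[|/eqP]; [left|right].
rewrite finite_setU; split => //; apply: IHn => //.
by move: sp; rewrite pE size_Mmonic ?monicXsubC // size_XsubC addn2.
Qed.

Section Moment.
Context {R : realType}.
Implicit Types (t x : R) (p q : {poly R}).
Local Notation mu := (@lebesgue_measure R).

(** Integrals over symmetric bounded intervals are within reach of the
    fundamental theorem of calculus and of the substitution x -> -x; dominated
    convergence transports their conclusions to the whole line. *)
Lemma cvg_Rintegral_symmetric (f : R -> R) :
  mu.-integrable setT (EFin \o f) ->
  (\int[mu]_(x in `[- n%:R, n%:R]) f x) @[n --> \oo]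
    --> \int[mu]_(x in setT) f x.
Proof.
move=> fi; have mf := measurable_int _ fi.
pose f_ n : R -> \bar R := (EFin \o f) \_ `[- n%:R, n%:R].
have mf_ n : measurable_fun setT (f_ n).
  by apply/(measurable_restrictT _ _).1 => //; exact: measurable_funTS.
have fabs : mu.-integrable setT (fun x => `|(EFin \o f) x|%E).
  exact: integrable_abse.
have cvf : {ae mu, forall x, setT x -> f_ ^~ x @ \oo --> (EFin \o f) x}.
  apply: aeW => x _; apply: cvg_near_cst; near=> n.
  rewrite /f_ patchE ifT // inE /= in_itv /= -ler_norml.
  by near: n; exact: nbhs_infty_ger.
have dom : {ae mu, forall x n, setT x -> (`|f_ n x| <= `|(EFin \o f) x|)%E}.
  apply: aeW => x n _; rewrite /f_ patchE; case: ifP => // _.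
  by rewrite abse0 abse_ge0.
have [_ _ lim] :=
  @dominated_convergence _ _ _ mu setT measurableT f_ _ _ mf_ mf cvf fabs dom.
apply: fine_cvg; rewrite fineK ?integrable_fin_num //.
rewrite [X in X @ \oo --> _](_ : _ =
  [sequence (\int[mu]_(x in setT) f_ n x)%E]_n) //.
by apply/funext => n /=; rewrite -integral_mkcond.
Unshelve. all: by end_near. Qed.

Definition freud_moment t p : R :=
  \int[mu]_(x in [set: R]) (p.[x] * freud_weight t x).

Lemma freud_ipE t p q : freud_ip t p q = freud_moment t (p * q).
Proof. by apply: eq_Rintegral => x _; rewrite hornerM. Qed.

Lemma freud_moment_is_linear t : scalar (freud_moment t).
Proof.
move=> c p q; rewrite /freud_moment -RintegralZl ?integrable_poly_weight //.
rewrite -RintegralD //; last exact: integrable_poly_weight.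
  by apply: eq_Rintegral => x _; rewrite hornerD hornerZ mulrDl mulrA.
have := integrable_poly_weight t (c *: p).
by under [X in mu.-integrable _ X -> _]eq_fun do rewrite /= hornerZ -mulrA.
Qed.

HB.instance Definition _ t :=
  GRing.isLinear.Build R {poly R} R _ (freud_moment t) (freud_moment_is_linear t).

Lemma freud_moment_reflect t p : freud_moment t (p \Po - 'X) = freud_moment t p.
Proof.
have cvp := cvg_Rintegral_symmetric (integrable_poly_weight t p).
have cvq := cvg_Rintegral_symmetric (integrable_poly_weight t (p \Po - 'X)).
rewrite (_ : (fun n => _) = (fun n =>
  \int[mu]_(x in `[- n%:R, n%:R]) (p.[x] * freud_weight t x))) in cvq.
  exact: (cvg_unique _ cvq cvp).
apply/funext => n; rewrite /Rintegral -[X in `[_, X]](opprK n%:R).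
rewrite integration_by_substitution_oppr ?opprK //; first last.
- by apply: continuous_subspaceT => y; exact: continuous_poly_weight.
- by rewrite -subr_ge0 opprK addr_ge0.
congr fine; apply: eq_integral => x _ /=.
by rewrite horner_comp !hornerE opprK freud_weightN.
Qed.

(** The derivative of x^4 - 2 t x^2, that is -w'/w for the weight w. *)
Definition freud_log_deriv t : {poly R} := 4 *: 'X^3 - (4 * t) *: 'X.

Lemma is_derive_poly_weight t p x :
  is_derive x 1 (fun y => p.[y] * freud_weight t y)
    ((p^`() - p * freud_log_deriv t).[x] * freud_weight t x).
Proof.
have -> : freud_weight t = expR \o horner (- 'X^4 + (2 * t) *: 'X^2).
  by apply/funext => y /=; rewrite /freud_weight !hornerE.
apply: trigger_derive.
rewrite /= /GRing.scale /= /freud_log_deriv !poly.derivE !hornerE /=.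
ring.
Qed.

Lemma cvg_poly_weight0 t p (u : nat -> R) :
  (forall n, gauss_fun (u n) = gauss_fun n%:R) ->
  p.[u n] * freud_weight t (u n) @[n --> \oo] --> (0 : R).
Proof.
move=> uE; have [C CP] := poly_weight_le_gauss t p.
apply/norm_cvg0P; apply: (@squeeze_cvgr _ _ _ _ (cst 0)
  (fun n => C * gauss_fun n%:R)).
- by apply: nearW => n /=; rewrite normr_ge0 -uE CP.
- exact: cvg_cst.
- rewrite -[X in _ --> X](mulr0 C); apply: cvgMr.
  exact: (cvg_comp _ _ cvgr_idn (@cvg_gauss_fun R)).
Qed.

(** Integration by parts: (p w)' = (p' - p (4 x^3 - 4 t x)) w, and p w has
    limit 0 at both ends of the line. *)
Lemma freud_moment_deriv t p :
  freud_moment t p^`() = freud_moment t (p * freud_log_deriv t).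
Proof.
apply/eqP; rewrite -subr_eq0 -linearB; apply/eqP.
set q := p^`() - _; pose f y := p.[y] * freud_weight t y.
have cvq := cvg_Rintegral_symmetric (integrable_poly_weight t q).
suff cv0 : \int[mu]_(x in `[- n%:R, n%:R]) (q.[x] * freud_weight t x)
    @[n --> \oo] --> (0 : R) by exact: (cvg_unique _ cvq cv0).
have cvF : f n%:R - f (- n%:R) @[n --> \oo] --> (0 : R).
  rewrite -[X in _ --> X](subr0 0); apply: cvgB; apply: cvg_poly_weight0 => // n.
  by rewrite /gauss_fun sqrrN.
apply: cvg_trans cvF; apply: near_eq_cvg; near=> n.
have n0 : (0 < n)%N by near: n; exact: nbhs_infty_gt.
have df (y : R) : is_derive y 1 f (q.[y] * freud_weight t y).
  exact: is_derive_poly_weight.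
rewrite /Rintegral (@continuous_FTC2 _ _ f) //.
- by rewrite -subr_gt0 opprK addr_gt0 ?ltr0n.
- by apply: continuous_subspaceT => y; exact: continuous_poly_weight.
- split=> [y _| |]; first exact: ex_derive.
  + by apply: cvg_at_right_filter; exact: continuous_poly_weight.
  + by apply: cvg_at_left_filter; exact: continuous_poly_weight.
- by move=> y _; rewrite derive1E derive_val.
Unshelve. all: by end_near. Qed.

(** If the integral of p^2 w vanished, p would vanish almost everywhere, so
    the line would be covered by a null set and the finite root set of p. *)
Lemma freud_moment_gt0 t p : p != 0 -> 0 < freud_moment t (p * p).
Proof.
move=> p0; rewrite lt_def; apply/andP; split; last first.
  apply: Rintegral_ge0 => x _.
  by rewrite hornerM mulr_ge0 -?expr2 ?sqr_ge0 // ltW ?freud_weight_gt0.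
apply/eqP => int0.
pose g x := (p * p).[x] * freud_weight t x.
have fi : mu.-integrable setT (EFin \o g) :=
  integrable_poly_weight t (p * p).
have : (\int[mu]_(x in setT) `|(EFin \o g) x| = 0)%E.
  under eq_integral => x _.
    rewrite gee0_abs; last first.
      rewrite /= lee_fin /g hornerM mulr_ge0 -?expr2 ?sqr_ge0 //.
      by rewrite ltW ?freud_weight_gt0.
    over.
  rewrite -[LHS]fineK; first by congr EFin.
  exact: integrable_fin_num fi.
move/(ae_eq_integral_abs _ measurableT (measurable_int _ fi)) => [N [mN N0 subN]].
have cp : countable [set x : R | root p x].
  exact/finite_set_countable/finite_root.
have mp : measurable [set x : R | root p x].
  by apply: countable_measurable => // y; exact: measurable_set1.
suff : mu setT = 0%E by rewrite -set_itvNyy lebesgue_measure_itv.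
apply: (@subset_measure0 _ _ _ mu _ (N `|` [set x | root p x])) => //.
- exact: measurableU.
- move=> x _; have [px|px] := boolP (root p x); [by right|left].
  apply: subN => /= /(_ I) /eqP; rewrite eqe /g hornerM !mulf_eq0.
  by rewrite -rootE (negPf px) /= gt_eqF ?freud_weight_gt0.
- by apply: null_set_setU => //; exact: countable_lebesgue_measure0.
Qed.

End Moment.

(** * Orthogonal polynomials of a positive linear form *)

Lemma size_sub_monic (K : nzRingType) n (p q : {poly K}) :
  p \is monic -> q \is monic -> size p = n.+1 -> size q = n.+1 ->
  (size (p - q)%R <= n)%N.
Proof.
move=> /monicP pm /monicP qm sp sq; apply/leq_sizeP => j.
rewrite leq_eqVlt coefB => /predU1P[<-|nj].
  by move: pm qm; rewrite /lead_coef sp sq /= => -> ->; rewrite subrr.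
by rewrite !nth_default ?subrr ?sp ?sq.
Qed.

Section OrthogonalPolynomials.
Context {K : realFieldType} (L : {scalar {poly K}}) (P : nat -> {poly K}).
Context (L_gt0 : forall p, p != 0 -> 0 < L (p * p)).
Context (P_monic : forall n, P n \is monic).
Context (size_P : forall n, size (P n) = n.+1).
Context (P_orth : forall m n, m != n -> L (P m * P n) = 0).
Implicit Types (p q r : {poly K}) (m n k : nat).
Local Notation h n := (L (P n * P n)).

Let LZ c p : L (c *: p) = c * L p. Proof. exact: linearZ. Qed.


Lemma sqnorm_gt0 n : 0 < h n.
Proof. exact/L_gt0/monic_neq0. Qed.

(** Orthogonality to a polynomial extends from P_0, ..., P_{m-1} to their
    span. The form L and the family P are unrelated here, so that P may be
    orthogonal for a different form than L. *)
Lemma orth_span m r q : (size r <= m)%N ->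
  (forall k, (k < m)%N -> L (P k * q) = 0) -> L (r * q) = 0.
Proof.
elim: m r => [|m IHm] r rm Pq.
  by move: rm; rewrite leqn0 size_poly_eq0 => /eqP->; rewrite mul0r linear0.
rewrite -{1}(subrK (r`_m *: P m) r) mulrDl linearD /= -scalerAl LZ Pq //.
rewrite mulr0 addr0; apply: IHm => [|k km]; last exact/Pq/ltnW.
apply/leq_sizeP => j; rewrite leq_eqVlt coefB coefZ => /predU1P[<-|mj].
  have /monicP := P_monic m; rewrite /lead_coef size_P /= => ->.
  by rewrite mulr1 subrr.
by rewrite [r`_j]nth_default ?[(P m)`_j]nth_default ?mulr0 ?subrr ?size_P // (leq_trans rm).
Qed.

Lemma orth_lower n r : (size r <= n)%N -> L (r * P n) = 0.
Proof. by move=> rn; apply: (orth_span rn) => k kn; rewrite P_orth // neq_ltn kn. Qed.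

Lemma orth_monic n q : q \is monic -> size q = n.+1 -> L (q * P n) = h n.
Proof.
move=> qm sq; rewrite -(subrK (P n) q) mulrDl linearD /= orth_lower ?add0r //.
exact: size_sub_monic.
Qed.

Lemma orth_eq0 n q : (size q <= n)%N ->
  (forall k, (k < n)%N -> L (P k * q) = 0) -> q = 0.
Proof.
move=> qn Pq; apply/eqP; apply: contraT => /L_gt0.
by rewrite (orth_span qn Pq) ltxx.
Qed.

Lemma orth_unique n q : q \is monic -> size q = n.+1 ->
  (forall k, (k < n)%N -> L (P k * q) = 0) -> q = P n.
Proof.
move=> qm sq Pq; apply/eqP; rewrite -subr_eq0; apply/eqP.
apply: (@orth_eq0 n) => [|k kn]; first exact: size_sub_monic.
by rewrite mulrBr linearB /= Pq // P_orth ?subr0 // neq_ltn kn.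
Qed.

(** The kernel K_{n-1}(x, 0) as a polynomial in x. *)
Definition kernel_poly n : {poly K} := \sum_(k < n) ((P k).[0] / h k) *: P k.

Lemma size_kernel_poly n : (size (kernel_poly n) <= n)%N.
Proof.
apply: (leq_trans (size_sum _ _ _)); apply/bigmax_leqP => k _.
by rewrite (leq_trans (size_scale_leq _ _)) // size_P.
Qed.

Lemma kernel_poly_reproducing n k : (k < n)%N ->
  L (P k * kernel_poly n) = (P k).[0].
Proof.
move=> kn; rewrite /kernel_poly mulr_sumr linear_sum /= (bigD1 (Ordinal kn)) //=.
rewrite -scalerAr LZ mulrVK ?unitfE ?gt_eqF ?sqnorm_gt0 //.
rewrite big1 ?addr0 // => i ik.
rewrite -scalerAr LZ [L (P k * _)]P_orth ?mulr0 //.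
by apply: contra ik => /eqP ki; apply/eqP/val_inj.
Qed.

Section Symmetric.
Context (L_reflect : forall p, L (p \Po - 'X) = L p).

(** The reflected polynomial, normalised to be monic, satisfies the conditions
    that characterise P_n. *)
Lemma orth_parity n : P n \Po - 'X = (-1) ^+ n *: P n.
Proof.
suff E : (-1) ^+ n *: (P n \Po - 'X) = P n.
  by rewrite -{2}E scalerA -exprMn mulrNN mulr1 expr1n scale1r.
have sX : size (- 'X : {poly K}) = 2 by rewrite size_polyN size_polyX.
have s1 : (-1) ^+ n != 0 :> K by rewrite signr_eq0.
apply: orth_unique => [||k kn].
- apply/monicP; rewrite lead_coefZ lead_coef_comp ?sX // size_P /=.
  rewrite (monicP (P_monic n)) lead_coefN lead_coefX mul1r -exprMn mulrNN mulr1.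
  by rewrite expr1n.
- by rewrite size_scale // size_comp_poly2.
- rewrite -scalerAr LZ -L_reflect rmorphM /= -comp_polyA rmorphN /=.
  rewrite comp_polyX opprK comp_polyXr orth_lower ?mulr0 //.
  by rewrite size_comp_poly2 // size_P.
Qed.

Lemma orth_at0 n : odd n -> (P n).[0] = 0.
Proof.
move=> on; have /(congr1 (horner^~ 0)) := orth_parity n.
rewrite horner_comp !hornerE oppr0 -signr_odd on expr1 mulN1r => /eqP.
by rewrite -addr_eq0 -mulr2n mulrn_eq0 => /eqP.
Qed.

Lemma orth_at0_consecutive n : (P n).[0] * (P n.+1).[0] = 0.
Proof.
by have [/orth_at0->|/(@orth_at0 n.+1)->] := boolP (odd n);
  rewrite ?mul0r ?mulr0.
Qed.

Lemma orth_X_sqr n : L ('X * P n * P n) = 0.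
Proof.
have := L_reflect ('X * P n * P n).
rewrite !rmorphM /= comp_polyX orth_parity -!(scalerAr, scalerAl) scalerA.
rewrite -exprMn mulrNN mulr1 expr1n scale1r !mulNr linearN /= => /eqP.
by rewrite eq_sym -addr_eq0 -mulr2n mulrn_eq0 => /eqP.
Qed.

(** At index 0 the coefficient is 0, so the recurrence holds there whatever
    polynomial stands for the predecessor of P_0. *)
Definition recurrence_coef n : K := if n is m.+1 then h n / h m else 0.

(** By degree, x P_n - P_{n+1} can only meet P_k with n - 1 <= k <= n, and
    parity excludes k = n. *)
Lemma three_term n : 'X * P n = P n.+1 + recurrence_coef n *: P n.-1.
Proof.
apply/eqP; rewrite -subr_eq0; apply/eqP.
have sXP k : size ('X * P k) = k.+2.
  by rewrite mulrC size_mulX ?monic_neq0 ?size_P.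
have XPm k : 'X * P k \is monic by rewrite monicMl ?monicX.
apply: (@orth_eq0 n.+1) => [|k kn].
  rewrite opprD addrA (leq_trans (size_polyD _ _)) // geq_max.
  rewrite size_sub_monic //= size_polyN (leq_trans (size_scale_leq _ _)) //.
  by rewrite size_P; case: (n).
rewrite mulrBr linearB mulrDr linearD /= P_orth ?add0r; last by rewrite neq_ltn kn.
rewrite -scalerAr LZ mulrA (mulrC (P k)).
move: kn; rewrite ltnS leq_eqVlt => /predU1P[->|kn].
  rewrite orth_X_sqr; case: (n) => [|m] /=; first by rewrite mul0r subr0.
  by rewrite [L (P m.+1 * P m)]P_orth ?mulr0 ?subr0 // neq_ltn ltnSn orbT.
case: n kn => // n; rewrite ltnS leq_eqVlt => /predU1P[->|kn] /=.
  rewrite orth_monic // divfK ?subrr // gt_eqF //; exact: sqnorm_gt0.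
have -> : L ('X * P k * P n.+1) = 0 by rewrite orth_lower ?sXP.
have -> : L (P k * P n) = 0 by rewrite orth_lower ?size_P.
by rewrite mulr0 subr0.
Qed.

Lemma christoffel_darboux0 n :
  'X * kernel_poly n.+1 =
    (h n)^-1 *: ((P n).[0] *: P n.+1 - (P n.+1).[0] *: P n).
Proof.
elim: n => [|n IHn].
  have -> : kernel_poly 1 = ((P 0%N).[0] / h 0%N) *: P 0%N.
    by rewrite /kernel_poly big_ord1.
  rewrite -scalerAr three_term /= scale0r addr0 (@orth_at0 1) //.
  by rewrite scale0r subr0 scalerA mulrC.
have -> : kernel_poly n.+2 =
    kernel_poly n.+1 + ((P n.+1).[0] / h n.+1) *: P n.+1.
  by rewrite /kernel_poly big_ord_recr.
rewrite mulrDr IHn -scalerAr three_term /=.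
have P2 : (P n.+2).[0] = - (h n.+1 / h n * (P n).[0]).
  have /(congr1 (horner^~ 0)) := three_term n.+1; rewrite /= !hornerE => /esym/eqP.
  by rewrite addr_eq0 => /eqP.
rewrite P2.
have hn : h n != 0 by rewrite gt_eqF ?sqnorm_gt0.
have hn1 : h n.+1 != 0 by rewrite gt_eqF ?sqnorm_gt0.
apply/polyP => i; rewrite !(coefB, coefD, coefN, coefZ); field.
by rewrite hn.
Qed.

End Symmetric.
End OrthogonalPolynomials.

(** * Freud polynomials *)

Section Freud.
Context {R : realType} (t : R) (F : nat -> {poly R}).
Context (hF : monic_orthogonal_sequence (freud_ip t) F).
Implicit Types (n m k : nat).
Local Notation L := (freud_moment t : {scalar {poly R}}).
Local Notation a := (freud_a2 t F).

Lemma freud_monic n : F n \is monic. Proof. by case: hF. Qed.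
Lemma freud_size n : size (F n) = n.+1. Proof. by case: hF. Qed.
Lemma freud_orth m n : m != n -> L (F m * F n) = 0.
Proof. by case: hF => _ _ oF /oF; rewrite freud_ipE. Qed.

Lemma freud_sqnormE n : freud_sqnorm t (F n) = L (F n * F n).
Proof. exact: freud_ipE. Qed.

Lemma freud_sqnorm_gt0 n : 0 < freud_sqnorm t (F n).
Proof.
rewrite freud_sqnormE; apply: (@sqnorm_gt0 _ L); last exact: freud_monic.
exact: freud_moment_gt0.
Qed.

Lemma freud_three_term n : 'X * F n = F n.+1 + a n *: F n.-1.
Proof.
have -> : a n = recurrence_coef L F n.
  by case: n => // n; rewrite /a !freud_sqnormE.
apply: (@three_term _ L) => //.
- exact: freud_moment_gt0.
- exact: freud_monic.
- exact: freud_size.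
- exact: freud_orth.
- exact: freud_moment_reflect.
Qed.

(** For k < n, L(F_k F_n') = L(F_k F_n (4 x^3 - 4 t x)) by integration by
    parts. By the recurrence, F_n (4 x^3 - 4 t x) is the right-hand side up to
    a combination of F_{n+1} and F_{n+3}, which does not see F_k; so both
    sides, being of degree less than n, have the same products with each F_k. *)
Lemma freud_structure n : (F n)^`() =
  (4 * a n) *: (('X^2 + (a n + a n.+1 - t)%:P) * F n.-1 - 'X * F n).
Proof.
case: n => [|n].
  have -> : F 0%N = ((F 0%N)`_0)%:P by apply: size1_polyC; rewrite freud_size.
  by rewrite derivC mulr0 scale0r.
set rhs := (X in _ = X).
have rhsE : F n.+1 * freud_log_deriv t - rhs =
    4 *: F n.+4 + (4 * (a n.+3 + a n.+2 + a n.+1 - t)) *: F n.+2.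
  have E k : F k.+1 = 'X * F k - a k *: F k.-1 by rewrite freud_three_term addrK.
  rewrite /rhs (E n.+3) (E n.+2) (E n.+1) /= /freud_log_deriv -!mul_polyC.
  ring.
apply/eqP; rewrite -subr_eq0; apply/eqP.
apply: (orth_eq0 (@freud_moment_gt0 _ t) freud_monic freud_size (n := n.+1)) => [|k kn].
  (* the leading terms of x^2 F_(n-1) and x F_n cancel *)
  have -> : rhs = (4 * a n.+1) *:
      ((a n.+1 + a n.+2 - t) *: F n + a n *: ('X * F n.-1)).
    have E : F n.+1 = 'X * F n - a n *: F n.-1 by rewrite freud_three_term addrK.
    by rewrite /rhs /= E -!mul_polyC; ring.
  have sD (p q : {poly R}) : (size p <= n.+1)%N -> (size q <= n.+1)%N ->
      (size (p + q)%R <= n.+1)%N.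
    by move=> sp sq; rewrite (leq_trans (size_polyD _ _)) // geq_max sp.
  have sZ (c : R) (p : {poly R}) :
      (size p <= n.+1)%N -> (size (c *: p)%R <= n.+1)%N.
    exact/leq_trans/size_scale_leq.
  apply: (sD).
    by rewrite -ltnS -[n.+2](freud_size n.+1) lt_size_deriv // monic_neq0 ?freud_monic.
  rewrite size_polyN; apply: (sZ); apply: (sD); first by apply: (sZ); rewrite freud_size.
  case: (n) => [|m]; first by rewrite scale0r size_poly0.
  apply: (leq_trans (size_scale_leq _ _)).
  by rewrite mulrC size_mulX ?monic_neq0 ?freud_monic // freud_size.
have -> : F k * ((F n.+1)^`() - rhs) = (F k * F n.+1)^`() - (F k)^`() * F n.+1
    - F k * F n.+1 * freud_log_deriv t
    + F k * (F n.+1 * freud_log_deriv t - rhs).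
  by rewrite derivM; ring.
rewrite rhsE linearD !linearB /= freud_moment_deriv.
have lower m (p : {poly R}) : (size p <= m)%N -> L (p * F m) = 0.
  exact: (orth_lower freud_monic freud_size freud_orth).
rewrite lower; last first.
  rewrite -ltnS (leq_trans (lt_size_deriv _)) ?monic_neq0 ?freud_monic //.
  by rewrite freud_size ltnW.
rewrite subr0 subrr add0r mulrDr -!scalerAr linearD !linearZ /=.
have kn2 : (k.+1 <= n.+2)%N by exact: ltnW.
have kn4 : (k.+1 <= n.+4)%N by rewrite (leq_trans kn2) // ltnW.
by rewrite !lower ?freud_size ?mulr0 ?addr0.
Qed.
End Freud.

(** * Freud-type polynomials *)

Section FreudType.
Context {R : realType} (t M : R) (F Q : nat -> {poly R}).
Context (M_gt0 : 0 < M).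
Context (hF : monic_orthogonal_sequence (freud_ip t) F).
Context (hQ : monic_orthogonal_sequence (freud_type_ip t M) Q).
Implicit Types (n m k : nat) (p q : {poly R}).
Local Notation L := (freud_moment t : {scalar {poly R}}).
Local Notation K n := (kernel_poly L F n).
Local Notation d n := (1 + M * kernel_pred t F n 0 0).
Local Notation b := (freud_b t M F).

Definition freud_type_moment p : R := freud_moment t p + M * p.[0].

Lemma freud_type_moment_is_linear : scalar freud_type_moment.
Proof.
move=> c p q; rewrite /freud_type_moment linearP /= hornerD hornerZ.
by rewrite /GRing.scale /=; ring.
Qed.

HB.instance Definition _ :=
  GRing.isLinear.Build R {poly R} R _ freud_type_moment freud_type_moment_is_linear.

Lemma freud_type_ipE p q : freud_type_ip t M p q = freud_type_moment (p * q).
Proof. by rewrite /freud_type_ip /freud_type_moment freud_ipE hornerM mulrA. Qed.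

Lemma freud_type_moment_gt0 p : p != 0 -> 0 < freud_type_moment (p * p).
Proof.
move=> p0; rewrite /freud_type_moment ltr_pwDl ?freud_moment_gt0 // hornerM.
by rewrite mulr_ge0 ?(ltW M_gt0) // -expr2 sqr_ge0.
Qed.

Lemma kernel_predE n : kernel_pred t F n 0 0 = (K n).[0].
Proof.
rewrite /kernel_pred /kernel_poly horner_sum; apply: eq_bigr => k _.
by rewrite hornerZ freud_sqnormE mulrAC.
Qed.

Lemma one_add_kernel_gt0 n : 0 < d n.
Proof.
rewrite ltr_pwDl // mulr_ge0 ?(ltW M_gt0) // sumr_ge0 // => k _.
by rewrite mulr_ge0 ?invr_ge0 ?(ltW (freud_sqnorm_gt0 hF _)) // -expr2 sqr_ge0.
Qed.

Lemma kernel_predS n : kernel_pred t F n.+1 0 0 =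
  kernel_pred t F n 0 0 + (F n).[0] ^+ 2 / freud_sqnorm t (F n).
Proof. by rewrite /kernel_pred big_ord_recr. Qed.

Lemma freud_bE n : b n - 1 = M * (F n).[0] ^+ 2 / freud_sqnorm t (F n) / d n.
Proof.
have dn := one_add_kernel_gt0 n.
rewrite /freud_b kernel_predS; field.
by rewrite !gt_eqF // freud_sqnorm_gt0.
Qed.

Lemma freud_at0_consecutive n : (F n).[0] * (F n.+1).[0] = 0.
Proof.
apply: (@orth_at0_consecutive _ L).
- exact: freud_moment_gt0.
- exact: freud_monic hF.
- exact: freud_size hF.
- exact: freud_orth hF.
- exact: freud_moment_reflect.
Qed.

(** b_n differs from 1 by a multiple of F_n(0)^2. *)
Lemma freud_b_consecutive n : (b n - 1) * (b n.+1 - 1) = 0.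
Proof.
rewrite !freud_bE; have /eqP := freud_at0_consecutive n.
by rewrite mulf_eq0 => /orP[] /eqP ->; rewrite expr0n /= !(mulr0, mul0r).
Qed.

(** The point mass contributes M F_k(0) q(0) to the product of F_k with q; the
    multiple of the kernel is chosen so that its reproducing property
    compensates this for all k < n at once. *)
Lemma freud_typeE n : Q n = F n - (M * (F n).[0] / d n) *: K n.
Proof.
have [mQ sQ oQ] := hQ.
have sK : (size (K n) <= n)%N by apply: size_kernel_poly; exact: freud_size hF.
have sF : size (F n) = n.+1 := freud_size hF n.
have sZ : (size (- ((M * (F n).[0] / d n) *: K n))%R < size (F n))%N.
  by rewrite size_polyN sF ltnS (leq_trans (size_scale_leq _ _)).
have oQ' i j : i != j -> freud_type_moment (Q i * Q j) = 0.
  by move=> /oQ; rewrite freud_type_ipE.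
apply/esym; apply: (orth_unique freud_type_moment_gt0 mQ sQ oQ').
- by rewrite monicE lead_coefDl // -monicE (freud_monic hF).
- by rewrite size_polyDl.
- move=> k kn; set q := F n - _.
  apply: (@orth_span _ freud_type_moment F
    (freud_monic hF) (freud_size hF) k.+1).
    by rewrite sQ.
  move=> j jk; have jn : (j < n)%N := leq_trans jk kn.
  have reproj : L (F j * K n) = (F j).[0].
    apply: kernel_poly_reproducing => //; first exact: freud_moment_gt0.
      exact: freud_monic hF.
    exact: freud_orth hF.
  rewrite /= /freud_type_moment /q mulrBr -scalerAr linearB /=.
  rewrite [freud_moment t (_ *: _)]linearZ /= reproj.
  rewrite (freud_orth hF) ?neq_ltn ?jn // hornerD hornerN hornerZ !hornerM -kernel_predE.
  by field; rewrite gt_eqF ?one_add_kernel_gt0.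
Qed.

(** Using K_n in place of K_{n-1} makes Christoffel-Darboux express the kernel
    by F_n and F_{n+1}, uniformly in n >= 0. *)
Lemma freud_type_connection n :
  'X * Q n = b n *: ('X * F n) - (b n - 1) *: F n.+1.
Proof.
have cd : 'X * K n.+1 =
    (freud_sqnorm t (F n))^-1 *: ((F n).[0] *: F n.+1 - (F n.+1).[0] *: F n).
  rewrite freud_sqnormE; apply: christoffel_darboux0.
  - exact: freud_moment_gt0.
  - exact: freud_monic hF.
  - exact: freud_size hF.
  - exact: freud_orth hF.
  - exact: freud_moment_reflect.
have KS : K n.+1 = K n + ((F n).[0] / freud_sqnorm t (F n)) *: F n.
  by rewrite /kernel_poly big_ord_recr freud_sqnormE.
have h0 : freud_sqnorm t (F n) != 0 by rewrite gt_eqF ?freud_sqnorm_gt0.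
have d0 : d n != 0 by rewrite gt_eqF ?one_add_kernel_gt0.
have bE : b n = 1 + M * (F n).[0] ^+ 2 / freud_sqnorm t (F n) / d n.
  by rewrite -freud_bE addrC subrK.
rewrite freud_typeE.
rewrite -[K n](addrK (((F n).[0] / freud_sqnorm t (F n)) *: F n)) -KS.
rewrite mulrBr -scalerAr mulrBr cd -scalerAr -!mul_polyC.
(* the coefficient of the added term is zero by parity *)
transitivity ((b n)%:P * ('X * F n) - (b n - 1)%:P * F n.+1
  + (M / d n / freud_sqnorm t (F n) * ((F n).[0] * (F n.+1).[0]))%:P * F n); last first.
  by rewrite freud_at0_consecutive mulr0 mul0r addr0.
apply/polyP => i; rewrite !(coefB, coefD, coefN, coefCM) freud_bE bE.
set x := ('X * F n)`_i.
by field; rewrite h0.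
Qed.
End FreudType.

(** * Elimination between two ladder relations *)

(** Differentiate the first relation, take v' from the second one and v from
    the first one again; the factor A D clears the denominators. *)
Lemma ladder_elimination (K : comNzRingType) (A B C D E u v : {poly K}) :
  D * u^`() = A * v - B * u -> D * v^`() = C * v - E * u ->
  A * D ^+ 2 * u^`(2)
    + D * (A * D^`() - A^`() * D + A * (B - C)) * u^`()
    + (D * (A * B^`() - A^`() * B) + A * (A * E - C * B)) * u = 0.
Proof.
move=> Hu Hv; rewrite derivSn derivn1.
have Hu' : D^`() * u^`() + D * u^`()^`() =
    A^`() * v + A * v^`() - (B^`() * u + B * u^`()).
  by rewrite -!derivM -derivB -Hu.
have Du2 : D * u^`()^`() =
    A^`() * v + A * v^`() - (B^`() * u + B * u^`()) - D^`() * u^`().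
  by rewrite -Hu' addrC addKr.
transitivity (D * A * (D * u^`()^`()) + A ^+ 2 * (E * u)
    + D * (A * D^`() - A^`() * D + A * (B - C)) * u^`()
    + (D * (A * B^`() - A^`() * B) - A * (C * B)) * u); first by ring.
have -> : E * u = C * v - D * v^`() by rewrite Hv opprB addrC subrK.
(* u'' and v' disappear here, leaving a multiple of the first relation *)
rewrite Du2.
transitivity ((D * A^`() + A * C) * (A * v - B * u - D * u^`())); first by ring.
by rewrite Hu subrr mulr0.
Qed.

Section LadderPolynomials.
Context {K : fieldType} (t a p q b c : K).

(** The polynomials below are the determinants Delta and Psi_ij after x / x has
    been cancelled and the multiples of (b - 1)(c - 1), which carry all the
    remaining powers 1/x, have been dropped. *)
Definition poly_Delta : {poly K} := c%:P * 'X^2.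

Definition poly_Psi11 : {poly K} :=
  (4 * a)%:P * 'X^2 * (q%:P + b%:P * ('X^2 - t%:P + a%:P)) - (a * (b - 1))%:P
  + (4 * a ^+ 2 * (b - 1))%:P * (b%:P * 'X^2 + ((b - 1) * (p + a - t))%:P).

Definition poly_Psi12 : {poly K} :=
  'X * ((4 * a * (1 - c))%:P * ('X^2 - t%:P + a%:P + q%:P)
        + (4 * c)%:P * 'X^2 * ('X^2 - t%:P + a%:P)
        + (4 * a * (b - 1) * c)%:P * ('X^2 - t%:P + p%:P + a%:P)).

Definition poly_Psi21 : {poly K} :=
  'X * ((4 * a * (1 - c))%:P * (q%:P + b%:P * ('X^2 - t%:P + a%:P))
        + (4 * a * c)%:P * (b%:P * 'X^2 + ((b - 1) * (p + a - t))%:P)).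

Definition poly_Psi22 : {poly K} :=
  (4 * a * (1 - c) ^+ 2)%:P * ('X^2 - t%:P + a%:P + q%:P)
  + (4 * c * (1 - c))%:P * 'X^2 * ('X^2 - t%:P + a%:P)
  - (c * (c - 1))%:P * ((4 * a)%:P * 'X^2 + 1%:P)
  + (4 * c ^+ 2)%:P * 'X^2 * ('X^2 - t%:P + p%:P + a%:P).

Section Ladder.
Context (bc : (b - 1) * (c - 1) = 0) (f g u v : {poly K}).
Context (f' : f^`() = (4 * a)%:P * (('X^2 + (a + q - t)%:P) * g - 'X * f)).
Context (g' : g^`() =
  4 * (('X^2 + (p + a - t)%:P) * ('X * g - f) - p%:P * ('X * g))).
Context (uE : 'X * u = 'X * f + (a * (b - 1))%:P * g).
Context (vE : 'X * v = (1 - c)%:P * f + c%:P * ('X * g)).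

Let bcP : b = 1 \/ c = 1.
Proof.
by have /eqP := bc; rewrite mulf_eq0 !subr_eq0 => /orP[] /eqP ->; [left|right].
Qed.

Let X2_inj : injective ( *%R ('X^2 : {poly K})).
Proof. by apply: mulfI; rewrite expf_neq0 ?polyX_eq0. Qed.

(* In each ladder relation, multiplying by x^2 removes the division by x that
   expresses u and v in terms of f and g; x^2 is cancelled afterwards. *)
Let X2u' : 'X^2 * u^`() = 'X^2 * f^`() + (a * (b - 1))%:P * ('X * g^`() - g).
Proof.
have := congr1 (fun p => 'X * p^`()) uE.
rewrite /= derivD !derivM derivX derivC mul0r add0r !mul1r mulrDr uE => E.
transitivity ('X * f + (a * (b - 1))%:P * g + 'X * ('X * u^`())
  - ('X * f + (a * (b - 1))%:P * g)); first by ring.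
rewrite E; ring.
Qed.

Let X2v' : 'X^2 * v^`() = (1 - c)%:P * ('X * f^`() - f) + c%:P * 'X^2 * g^`().
Proof.
have := congr1 (fun p => 'X * p^`()) vE.
rewrite /= derivD !derivM derivX !derivC !mul0r !add0r !mul1r mulrDr vE => E.
transitivity ((1 - c)%:P * f + c%:P * ('X * g) + 'X * ('X * v^`())
  - ((1 - c)%:P * f + c%:P * ('X * g))); first by ring.
rewrite E; ring.
Qed.

Lemma ladder_u : poly_Delta * u^`() = poly_Psi11 * v - poly_Psi21 * u.
Proof.
apply: X2_inj; transitivity (poly_Delta * ('X^2 * u^`())); first by ring.
transitivity ('X * poly_Psi11 * ('X * v) - 'X * poly_Psi21 * ('X * u));
  last by ring.
rewrite X2u' uE vE f' g' /poly_Delta /poly_Psi11 /poly_Psi21.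
by case: bcP => ->; ring.
Qed.

Lemma ladder_v : poly_Delta * v^`() = poly_Psi12 * v - poly_Psi22 * u.
Proof.
apply: X2_inj; transitivity (poly_Delta * ('X^2 * v^`())); first by ring.
transitivity ('X * poly_Psi12 * ('X * v) - 'X * poly_Psi22 * ('X * u));
  last by ring.
rewrite X2v' uE vE f' g' /poly_Delta /poly_Psi12 /poly_Psi22.
by case: bcP => ->; ring.
Qed.

End Ladder.
End LadderPolynomials.

(** * The coefficients of the holonomic equation *)

(** Agreement away from 0 suffices: nonzero points form an open set. *)
Lemma derive1_eq_poly (R : realType) (f : R -> R) (p : {poly R}) (x : R) :
  (forall y, y != 0 -> f y = p.[y]) -> x != 0 -> derive1 f x = p^`().[x].
Proof.
move=> fp x0; rewrite derive1E (@near_eq_derive _ _ _ f (horner p)).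
  by rewrite derive_val.
by near=> y; apply: fp; near: y; exact: open_neq.
Unshelve. all: by end_near. Qed.

Definition horner_rules :=
  (hornerD, hornerN, hornerM, hornerXn, hornerX, hornerZ, hornerC).

Section HolonomicCoefficients.
Context {R : realType} (t M : R) (F : nat -> {poly R}) (n : nat).
Local Notation a := (freud_a2 t F n).
Local Notation p := (freud_a2 t F n.-1).
Local Notation q := (freud_a2 t F n.+1).
Local Notation b := (freud_b t M F n).
Local Notation c := (freud_b t M F n.-1).
Context (bc : (b - 1) * (c - 1) = 0).

Local Notation pD := (poly_Delta c).
Local Notation p11 := (poly_Psi11 t a p q b).
Local Notation p12 := (poly_Psi12 t a p q b c).
Local Notation p21 := (poly_Psi21 t a p q b c).
Local Notation p22 := (poly_Psi22 t a p q c).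

Let bcP : b = 1 \/ c = 1.
Proof.
by have /eqP := bc; rewrite mulf_eq0 !subr_eq0 => /orP[] /eqP ->; [left|right].
Qed.

Lemma funDeltaE x : funDelta t M F n x = pD.[x].
Proof.
by rewrite /funDelta -(mulrA a) bc mulr0 addr0 /poly_Delta !horner_rules mulrC.
Qed.

Lemma Psi11E x : x != 0 -> Psi11 t M F n x = p11.[x].
Proof.
move=> x0; rewrite /Psi11 /det2 /funA1 /funB1 /funC1 /funD1.
rewrite /poly_Psi11 !horner_rules.
by field.
Qed.

Lemma Psi12E x : x != 0 -> Psi12 t M F n x = p12.[x].
Proof.
move=> x0; rewrite /Psi12 /det2 /funA1 /funB1 /funC2 /funD2.
rewrite /poly_Psi12 !horner_rules.
by case: bcP => ->; field.
Qed.

Lemma Psi21E x : x != 0 -> Psi21 t M F n x = p21.[x].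
Proof.
move=> x0; rewrite /Psi21 /det2 /funA2 /funB2 /funC1 /funD1.
rewrite /poly_Psi21 !horner_rules.
by case: bcP => ->; field.
Qed.

Lemma Psi22E x : x != 0 -> Psi22 t M F n x = p22.[x].
Proof.
move=> x0; rewrite /Psi22 /det2 /funA2 /funB2 /funC2 /funD2.
rewrite /poly_Psi22 !horner_rules.
by field.
Qed.

Definition poly_calA : {poly R} := p11 * pD ^+ 2.
Definition poly_calB : {poly R} :=
  pD * (p11 * pD^`() - p11^`() * pD + p11 * (p21 - p12)).
Definition poly_calC : {poly R} :=
  pD * (p11 * p21^`() - p11^`() * p21) + p11 * (p11 * p22 - p12 * p21).

Lemma poly_calA_explicit : poly_calA = explicitA t M F n.
Proof.
rewrite /explicitA /coefA8 /coefA6 /coefA4 /coefA2 /coefA0 -!mul_polyC.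
rewrite /poly_calA /poly_Psi11 /poly_Delta.
by case: bcP => ->; ring.
Qed.

Lemma poly_calB_explicit : poly_calB = explicitB t M F n.
Proof.
rewrite /explicitB /coefB11 /coefB9 /coefB7 /coefB5 /coefB3 /coefB1 -!mul_polyC.
rewrite /poly_calB /poly_Psi11 /poly_Psi12 /poly_Psi21 /poly_Delta !poly.derivE.
by case: bcP => ->; ring.
Qed.


Lemma calA_poly x : x != 0 -> calA t M F n x = poly_calA.[x].
Proof. by move=> x0; rewrite /calA Psi11E // funDeltaE /poly_calA !horner_rules. Qed.

Lemma calB_poly x : x != 0 -> calB t M F n x = poly_calB.[x].
Proof.
move=> x0; rewrite /calB /wronskian (derive1_eq_poly Psi11E x0).
rewrite (derive1_eq_poly (fun y _ => funDeltaE y) x0).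
rewrite Psi11E // Psi12E // Psi21E // funDeltaE /poly_calB.
by move: p11 p12 p21 pD => ? ? ? ?; rewrite !horner_rules.
Qed.

Lemma calC_poly x : x != 0 -> calC t M F n x = poly_calC.[x].
Proof.
move=> x0; rewrite /calC /wronskian /det2 (derive1_eq_poly Psi11E x0).
rewrite (derive1_eq_poly Psi21E x0) Psi11E // Psi12E // Psi21E // Psi22E //.
rewrite funDeltaE /poly_calC; move: p11 p12 p21 p22 pD => ? ? ? ? ?.
by rewrite !horner_rules.
Qed.

Lemma poly_calA_even x : poly_calA.[- x] = poly_calA.[x].
Proof. by rewrite poly_calA_explicit /explicitA !horner_rules; ring. Qed.

Lemma poly_calB_odd x : poly_calB.[- x] = - poly_calB.[x].
Proof. by rewrite poly_calB_explicit /explicitB !horner_rules; ring. Qed.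

Lemma poly_calC_even x : poly_calC.[- x] = poly_calC.[x].
Proof.
have e11 : p11.[- x] = p11.[x] by rewrite /poly_Psi11 !horner_rules; ring.
have o12 : p12.[- x] = - p12.[x] by rewrite /poly_Psi12 !horner_rules; ring.
have o21 : p21.[- x] = - p21.[x] by rewrite /poly_Psi21 !horner_rules; ring.
have e22 : p22.[- x] = p22.[x] by rewrite /poly_Psi22 !horner_rules; ring.
have eD : pD.[- x] = pD.[x] by rewrite /poly_Delta !horner_rules; ring.
have d11 : p11^`().[- x] = - p11^`().[x].
  by rewrite /poly_Psi11 !poly.derivE !horner_rules; ring.
have d21 : p21^`().[- x] = p21^`().[x].
  by rewrite /poly_Psi21 !poly.derivE !horner_rules; ring.
rewrite /poly_calC; move: p11 p12 p21 p22 pD e11 o12 o21 e22 eD d11 d21.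
move=> P11 P12 P21 P22 D e11 o12 o21 e22 eD d11 d21.
rewrite !horner_rules e11 o12 o21 e22 eD d11 d21.
ring.
Qed.

End HolonomicCoefficients.
Theorem theorem10 (R : realType) (t M : R) (n : nat) (F Q : nat -> {poly R})
    (ht : 0 < t) (hM : 0 < M) (hn : (1 <= n)%N)
    (hF : monic_orthogonal_sequence (freud_ip t) F)
    (hQ : monic_orthogonal_sequence (freud_type_ip t M) Q) :
  exists polA polB polC : {poly R},
    [/\ (forall x : R, x != 0 ->
           [/\ calA t M F n x = polA.[x],
               calB t M F n x = polB.[x] &
               calC t M F n x = polC.[x]]),
        (forall x : R, polA.[x] * (Q n)^`(2).[x] + polB.[x] * (Q n)^`().[x]
                       + polC.[x] * (Q n).[x] = 0),
        [/\ forall x : R, polA.[- x] = polA.[x],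
            forall x : R, polC.[- x] = polC.[x] &
            forall x : R, polB.[- x] = - polB.[x]],
        polA = explicitA t M F n &
        polB = explicitB t M F n].
Proof.
case: n hn => // n _.
have bc : (freud_b t M F n.+1 - 1) * (freud_b t M F n - 1) = 0.
  by rewrite mulrC freud_b_consecutive.
exists (poly_calA t M F n.+1), (poly_calB t M F n.+1), (poly_calC t M F n.+1).
have f1 : F n.+2 = 'X * F n.+1 - freud_a2 t F n.+1 *: F n.
  by rewrite (freud_three_term hF) addrK.
have pF : freud_a2 t F n *: F n.-1 = 'X * F n - F n.+1.
  by rewrite (freud_three_term hF) addrC addKr.
have f' := freud_structure hF n.+1.
have g' := freud_structure hF n.
have uE := freud_type_connection hM hF hQ n.+1.
have vE := freud_type_connection hM hF hQ n.
have uE' : 'X * Q n.+1 =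
    'X * F n.+1 + (freud_a2 t F n.+1 * (freud_b t M F n.+1 - 1))%:P * F n.
  by rewrite uE f1 -!mul_polyC; ring.
have vE' : 'X * Q n =
    (1 - freud_b t M F n)%:P * F n.+1 + (freud_b t M F n)%:P * ('X * F n).
  by rewrite vE -!mul_polyC; ring.
have f'' : (F n.+1)^`() = (4 * freud_a2 t F n.+1)%:P *
    (('X^2 + (freud_a2 t F n.+1 + freud_a2 t F n.+2 - t)%:P) * F n - 'X * F n.+1).
  by rewrite f' mul_polyC.
have g'' : (F n)^`() =
    4 * (('X^2 + (freud_a2 t F n + freud_a2 t F n.+1 - t)%:P) * ('X * F n - F n.+1)
         - (freud_a2 t F n)%:P * ('X * F n)).
  by rewrite g' -pF -!mul_polyC; ring.
split.
- move=> x x0; split; [exact: calA_poly|exact: calB_poly|exact: calC_poly].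
- move=> x.
  rewrite -!hornerM -!hornerD (ladder_elimination
    (ladder_u bc f'' g'' uE' vE') (ladder_v bc f'' g'' uE' vE')).
  exact: horner0.
- by split=> x; [exact: poly_calA_even|exact: poly_calC_even|exact: poly_calB_odd].
- exact: poly_calA_explicit.
- exact: poly_calB_explicit.
Qed.
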